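(* Let $\{A_\alpha\}_{\alpha\in F}$ be a nonempty indexed family of pm-rings (commutative with unity) and let $\psi_\alpha:A_\alpha\to\mathcal{P}(\Lambda_\alpha)$ be a transition map for each $\alpha\in F$. Suppose there exists a fixed positive integer $m$ such that for every $\alpha\in F$ and all $a_\alpha,b_\alpha\in A_\alpha$, $\psi_\alpha(a_\alpha)\cap\psi_\alpha(b_\alpha)=\emptyset$ implies that the ideal $(a_\alpha^m,b_\alpha^m)$ is principal. Then the product ring $\prod_{\alpha\in F}A_\alpha$ is a transitional ring.
   Context: All rings are commutative with unity. $\mathcal{P}(\Lambda)$ is the power set of $\Lambda$. For a ring $A$ and a nonempty set $\Lambda$, a map $\psi:A\to\mathcal{P}(\Lambda)$ is a semi-transition map on $A$ if: (i) $\psi(ab)=\psi(a)\cup\psi(b)$ for all $a,b\in A$; (ii) $\psi(1)=\emptyset$, and $\psi(a)=\Lambda$ if and only if $a=0$; (iii) for all $a,b\in A$ there is some $c$ in the ideal $(a,b)$ with $\psi(a)\cap\psi(b)=\psi(c)\subseteq\psi(a+b)$; moreover, if $\psi(a)\cap\psi(b)=\emptyset$, then the ideal $(a^m,b^n)$ is principal for some $m,n\in\mathbb{N}$ (positive integers). A pm-ring is a ring in which each prime ideal is contained in a unique maximal ideal. A transition map on $A$ is a semi-transition map $\psi:A\to\mathcal{P}(\Lambda)$, where $A$ is a pm-ring, such that: (T1) if $\lambda_1\neq\lambda_2$ in $\Lambda$, then there is $a\in A$ such that $\psi(a)$ contains exactly one of $\lambda_1,\lambda_2$; (T2) for all $\lambda\in\Lambda$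 and $a\in A$ with $\lambda\notin\psi(a)$, there is $b\in A$ with $\lambda\in\psi(b)$ and $\psi(a)\cap\psi(b)=\emptyset$. A ring is transitional if it is a pm-ring admitting a transition map. *)

(* Defs.v *)
From HB Require Import structures.
From mathcomp Require Import all_boot all_order all_algebra.
From mathcomp Require Import all_classical.

Set Implicit Arguments.
Unset Strict Implicit.
Unset Printing Implicit Defensive.

Import GRing.Theory.

Local Open Scope classical_set_scope.
Local Open Scope ring_scope.

(* Rings are [comPzRingType]s: the trivial ring is not excluded a priori.  The
   ideals of [ring_quotient] are boolean predicates on nontrivial rings and are
   always proper, hence the set-valued definitions below. *)

Section Ideals.
Variable A : comPzRingType.

Definition ideal (I : set A) : Prop :=
  [/\ I 0, (forall x y, I x -> I y -> I (x + y))
    & (forall a x, I x -> I (a * x))].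

Definition gen_ideal (S : set A) : set A := smallest ideal S.

Definition principal (I : set A) : Prop := exists d, I = gen_ideal [set d].

Definition prime_ideal (P : set A) : Prop :=
  [/\ ideal P, P <> [set: A] & forall x y, P (x * y) -> P x \/ P y].

Definition maximal_ideal (M : set A) : Prop :=
  [/\ ideal M, M <> [set: A]
    & forall J, ideal J -> M `<=` J -> J = M \/ J = [set: A]].

End Ideals.

Definition pm_ring (A : comPzRingType) : Prop :=
  forall P : set A, prime_ideal P ->
    exists! M : set A, maximal_ideal M /\ P `<=` M.

Record semi_transition_map (A : comPzRingType) (L : Type) (psi : A -> set L) :
    Prop := {
  stm_nonempty : inhabited L;
  stm_mul : forall a b, psi (a * b) = psi a `|` psi b;
  stm_one : psi 1 = set0;
  stm_full : forall a, psi a = [set: L] <-> a = 0;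
  stm_cap : forall a b, exists c,
    [/\ gen_ideal [set a; b] c, psi a `&` psi b = psi c
      & psi c `<=` psi (a + b)];
  stm_principal : forall a b, psi a `&` psi b = set0 ->
    exists m n : nat, [/\ (0 < m)%N, (0 < n)%N
      & principal (gen_ideal [set a ^+ m; b ^+ n])]
}.

Record transition_map (A : comPzRingType) (L : Type) (psi : A -> set L) :
    Prop := {
  tm_pm : pm_ring A;
  tm_semi : semi_transition_map psi;
  tm_T1 : forall l1 l2 : L, l1 <> l2 ->
    exists a, (psi a l1 /\ ~ psi a l2) \/ (~ psi a l1 /\ psi a l2);
  tm_T2 : forall (l : L) (a : A), ~ psi a l ->
    exists b, psi b l /\ psi a `&` psi b = set0
}.

Definition transitional (A : comPzRingType) : Prop :=
  pm_ring A /\ exists (L : Type) (psi : A -> set L), transition_map psi.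

(* Product of an arbitrary family of rings, with pointwise operations; the
   library only equips non-dependent function types [T -> R] with a ring
   structure. *)
Definition prod_ring (F : Type) (A : F -> comPzRingType) : Type :=
  forall i, A i.

Section ProdRing.
Variables (F : Type) (A : F -> comPzRingType).
Implicit Types f g h : prod_ring A.

HB.instance Definition _ := Choice.on (prod_ring A).

Let zero : prod_ring A := fun=> 0.
Let one : prod_ring A := fun=> 1.
Let opp f : prod_ring A := fun i => - f i.
Let add f g : prod_ring A := fun i => f i + g i.
Let mul f g : prod_ring A := fun i => f i * g i.

Let addA : associative add.
Proof. by move=> f g h; apply/functional_extensionality_dep => i; exact: addrA. Qed.

Let addC : commutative add.
Proof. by move=> f g; apply/functional_extensionality_dep => i; exact: addrC. Qed.

Let add0 : left_id zero add.
Proof. by move=> f; apply/functional_extensionality_dep => i; exact: add0r. Qed.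

Let addN : left_inverse zero opp add.
Proof. by move=> f; apply/functional_extensionality_dep => i; exact: addNr. Qed.

HB.instance Definition _ :=
  GRing.isZmodule.Build (prod_ring A) addA addC add0 addN.

Let mulA : associative mul.
Proof. by move=> f g h; apply/functional_extensionality_dep => i; exact: mulrA. Qed.

Let mulC : commutative mul.
Proof. by move=> f g; apply/functional_extensionality_dep => i; exact: mulrC. Qed.

Let mul1 : left_id one mul.
Proof. by move=> f; apply/functional_extensionality_dep => i; exact: mul1r. Qed.

Let mulDl : left_distributive mul add.
Proof. by move=> f g h; apply/functional_extensionality_dep => i; exact: mulrDl. Qed.

HB.instance Definition _ :=
  GRing.Zmodule_isComPzRing.Build (prod_ring A) mulA mulC mul1 mulDl.

End ProdRing.

(* Main.v *)
Require Import Defs.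
From mathcomp Require Import all_boot all_order all_algebra.
From mathcomp Require Import all_classical.
From mathcomp Require Import ring.

Set Implicit Arguments.
Unset Strict Implicit.
Unset Printing Implicit Defensive.

Import GRing.Theory.

Local Open Scope classical_set_scope.
Local Open Scope ring_scope.

(** The map sending [a] to the disjoint union of the sets [psi i (a i)] is a
    transition map on the product: every axiom is checked componentwise, the
    uniform exponent [m] being what makes the ideals [(a^m, b^m)] of the product
    principal.  That the product is a pm-ring follows from the elementwise
    characterization of pm-rings (Contessa): for every [a] there are [x] and [y]
    with [(1 - a x) (1 - (1 - a) y) = 0]. *)

(** * Existence of maximal and prime ideals *)

Section IdealTheory.
Variable A : comPzRingType.
Implicit Types (I J M P S : set A) (a b d x y : A).

Lemma idealT_1 I : ideal I -> I 1 -> I = [set: A].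
Proof.
move=> [_ _ IM] I1; apply/seteqP; split=> // x _.
by rewrite -[x]mulr1; exact: IM.
Qed.

Lemma proper_ideal_1 I : ideal I -> I <> [set: A] <-> ~ I 1.
Proof.
by move=> idI; split=> [IT /(idealT_1 idI)//|I1 IT]; apply: I1; rewrite IT.
Qed.

Definition ideal_adjoin I a : set A :=
  [set x | exists2 i, I i & exists c, x = i + c * a].

Lemma ideal_adjoinP I a : ideal I -> ideal (ideal_adjoin I a).
Proof.
move=> [I0 ID IM]; split.
- by exists 0 => //; exists 0; rewrite mul0r addr0.
- move=> _ _ [i Ii [c ->]] [j Ij [d ->]].
  by exists (i + j); [exact: ID | exists (c + d); rewrite mulrDl addrACA].
- move=> b _ [i Ii [c ->]]; exists (b * i); first exact: IM.
  by exists (b * c); rewrite mulrDr mulrA.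
Qed.

Lemma sub_ideal_adjoin I a : I `<=` ideal_adjoin I a.
Proof. by move=> x Ix; exists x => //; exists 0; rewrite mul0r addr0. Qed.

Lemma mem_ideal_adjoin I a : ideal I -> ideal_adjoin I a a.
Proof. by move=> [I0 _ _]; exists 0 => //; exists 1; rewrite mul1r add0r. Qed.

Lemma ideal0 : ideal [set (0 : A)].
Proof.
by split=> // [x y -> ->|a x ->]; [exact: addr0 | exact: mulr0].
Qed.

(** Zorn's lemma, used twice below: [S = [set 1]] yields maximal ideals, and a multiplicative [S]
    with [I = [set 0]] yields prime ideals. *)
Lemma exists_maximal_avoiding I S : ideal I -> I `&` S = set0 ->
  exists M, [/\ ideal M, I `<=` M, M `&` S = set0 &
    forall J, ideal J -> M `<=` J -> J `&` S = set0 -> J = M].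
Proof.
move=> idI IS.
(* [I `|` X] rather than [X] is required to be an ideal: the union of the empty
   chain is then admissible. *)
pose Q X := ideal (I `|` X) /\ (I `|` X) `&` S = set0.
have [C QC totC|X [[idX XS] maxX]] := @Zorn_bigcup _ Q.
  have UC X : C X -> I `|` X `<=` I `|` \bigcup_(X in C) X.
    by move=> CX; apply: setUS => z Xz; exists X.
  split; last first.
    rewrite -subset0 => z [[Iz|[X CX Xz]] Sz].
    - by rewrite -IS.
    - by rewrite -(QC _ CX).2; split => //; right.
  have [I0 ID IM] := idI; split; first by left.
  - have closed X z w : C X -> (I `|` X) z -> (I `|` X) w ->
        (I `|` \bigcup_(X in C) X) (z + w).
      by move=> CX Xz Xw; apply: (UC X) => //; case: (QC _ CX) => -[_ XD _] _; exact: XD.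
    move=> z w [Iz|[X CX Xz]] [Iw|[Y CY Yw]].
    + by left; exact: ID.
    + by apply: (closed Y) => //; [left|right].
    + by apply: (closed X) => //; [right|left].
    + have [XY|YX] := totC _ _ CX CY.
      * by apply: (closed Y) => //; right => //; exact: XY.
      * by apply: (closed X) => //; right => //; exact: YX.
  - move=> a z [Iz|[X CX Xz]]; first by left; exact: IM.
    by apply: (UC X) => //; case: (QC _ CX) => -[_ _ XM] _; apply: XM; right.
exists (I `|` X); split=> // J idJ XJ JS.
have IJ : I `|` J = J by apply/setUidPr => z Iz; apply: XJ; left.
apply/seteqP; split=> // z Jz; right; apply: contrapT => Xz.
apply: (maxX J); last by rewrite /Q IJ.
by split=> [w Xw|]; [apply: XJ; right | move=> /(_ z Jz)].
Qed.

Lemma exists_maximal_ideal I : ideal I -> ~ I 1 ->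
  exists M, maximal_ideal M /\ I `<=` M.
Proof.
have disj1 J : J `&` [set 1] = set0 <-> ~ J 1.
  split=> [J1 J1'|J1]; last by rewrite -subset0 => x [Jx x1]; apply: J1; rewrite -x1.
  by have : (J `&` [set 1]) 1 by []; rewrite J1.
move=> idI /disj1/(exists_maximal_avoiding idI)[M [idM IM /disj1 M1 maxM]].
exists M; split=> //; split=> //; first exact/proper_ideal_1.
move=> J idJ MJ; have [J1|J1] := pselect (J 1).
  by right; exact: idealT_1.
by left; apply: maxM => //; exact/disj1.
Qed.

(** An ideal [P] maximal among those disjoint from [S] is prime: for [x], [y] outside [P], both
    [P + (x)] and [P + (y)] meet [S], and if [x * y] were in [P], the product of the two meeting
    points would lie in both [P] and [S]. *)
Lemma exists_prime_avoiding S : S 1 -> (forall x y, S x -> S y -> S (x * y)) ->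
  ~ S 0 -> exists P, prime_ideal P /\ P `&` S = set0.
Proof.
move=> S1 SM S0.
have S0' : [set 0] `&` S = set0 by rewrite -subset0 => x [->].
have [P [idP _ PS maxP]] := exists_maximal_avoiding ideal0 S0'.
have meet a : ~ P a -> exists s, S s /\ ideal_adjoin P a s.
  move=> Pa; apply: contrapT => /forallNP nS; apply: Pa.
  rewrite -(maxP (ideal_adjoin P a)); first exact: mem_ideal_adjoin.
  - exact: ideal_adjoinP.
  - exact: sub_ideal_adjoin.
  - by rewrite -subset0 => x [Jx Sx]; apply: (nS x).
have avoid s : S s -> ~ P s.
  by move=> Ss Ps; have : (P `&` S) s by []; rewrite PS.
have [P0 PD PM] := idP.
exists P; split=> //; split=> //; first by apply/proper_ideal_1 => //; exact: avoid.
move=> x y Pxy; apply: contrapT => /not_orP[/meet[s [Ss [i Pi [c es]]]]].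
move=> /meet[t [St [j Pj [d et]]]]; apply: (avoid _ (SM _ _ Ss St)).
(* Each summand is a multiple of [i], [j] or [x * y], all in [P]. *)
have -> : s * t = t * i + ((c * x) * j + (c * d) * (x * y)) by rewrite es et; ring.
by do 2!(apply: (PD); [exact: PM|]); exact: PM.
Qed.

(** * Ideals with one or two generators *)

Lemma gen_ideal1E d : gen_ideal [set d] = [set x | exists u, x = u * d].
Proof.
apply/seteqP; split.
  apply: smallest_sub; last by move=> _ ->; exists 1; rewrite mul1r.
  split; first by exists 0; rewrite mul0r.
  - by move=> _ _ [u ->] [v ->]; exists (u + v); rewrite mulrDl.
  - by move=> a _ [u ->]; exists (a * u); rewrite mulrA.
by move=> _ [u ->] I [[_ _ IM] Id]; apply: IM; exact: Id.
Qed.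

Lemma gen_ideal2E a b :
  gen_ideal [set a; b] = [set x | exists u v, x = u * a + v * b].
Proof.
apply/seteqP; split.
  apply: smallest_sub.
    split; first by exists 0, 0; rewrite !mul0r addr0.
    - move=> _ _ [u [v ->]] [u' [v' ->]]; exists (u + u'), (v + v').
      by rewrite !mulrDl addrACA.
    - move=> c _ [u [v ->]]; exists (c * u), (c * v).
      by rewrite mulrDr !mulrA.
  move=> _ [->|->]; first by exists 1, 0; rewrite mul1r mul0r addr0.
  by exists 0, 1; rewrite mul1r mul0r add0r.
move=> _ [u [v ->]] I [[_ ID IM] Iab].
by apply: ID; apply: IM; apply: Iab; [left|right].
Qed.

(** Rephrases principality as solvability of equations, which can be solved componentwise in a
    product. *)
Lemma principal2P a b : principal (gen_ideal [set a; b]) <->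
  exists d x y u v, [/\ d = x * a + y * b, a = u * d & b = v * d].
Proof.
split=> [[d dE]|[d [x [y [u [v [dE aE bE]]]]]]].
- have [x [y dxy]] : exists x y, d = x * a + y * b.
    have : gen_ideal [set d] d by exact: sub_gen_smallest.
    by rewrite -dE gen_ideal2E.
  have mem_d c : [set a; b] c -> exists u, c = u * d.
    move=> /(@sub_gen_smallest _ (@ideal A)).
    by rewrite -/(gen_ideal _) dE gen_ideal1E.
  have [u au] := mem_d a (or_introl erefl).
  have [v bv] := mem_d b (or_intror erefl).
  by exists d, x, y, u, v.
- exists d; rewrite gen_ideal1E gen_ideal2E; apply/seteqP; split=> z.
    move=> [s [t ->]]; exists (s * u + t * v).
    by rewrite mulrDl -!mulrA -aE -bE.
  by move=> [s ->]; exists (s * x), (s * y); rewrite {1}dE mulrDr !mulrA.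
Qed.

(** * Contessa's elementwise criterion for pm-rings *)

Lemma pm_ringP : pm_ring A <->
  forall a, exists x y, (1 - a * x) * (1 - (1 - a) * y) = 0.
Proof.
split=> [pmA a|contessa P [idP /(proper_ideal_1 idP) P1 prP]].
- pose S := [set z | exists x y, z = (1 - a * x) * (1 - (1 - a) * y)].
  have [[x [y eq0]]|S0] := pselect (S 0); first by exists x, y.
  have S1 : S 1 by exists 0, 0; rewrite !mulr0 subr0 mulr1.
  have SM z w : S z -> S w -> S (z * w).
    move=> [x [y ->]] [x' [y' ->]].
    (* Comes from [(1 - a x)(1 - a x') = 1 - a (x + x' - a x x')], and likewise for [1 - a]. *)
    by exists (x + x' - a * x * x'), (y + y' - (1 - a) * y * y'); ring.
  have [P [prP PS]] := exists_prime_avoiding S1 SM S0.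
  have [M0 [[[idM0 M0T _] _] uM]] := pmA _ prP; have [idP _ _] := prP.
  (* [p + c * b = 1] with [p] in [P] would put [p = 1 - b * c] in [S]. *)
  have mem_M0 b : (forall x, S (1 - b * x)) -> M0 b.
    move=> Sb.
    have [|M [maxM bM]] := exists_maximal_ideal (ideal_adjoinP b idP).
      move=> [p Pp [c e]]; have : (P `&` S) (1 - b * c).
        by split => //; rewrite e [b * c]mulrC addrK.
      by rewrite PS.
    rewrite (uM M); first by apply: bM; exact: mem_ideal_adjoin.
    by split => //; apply: subset_trans bM; exact: sub_ideal_adjoin.
  (* The only maximal ideal above [P] contains both [a] and [1 - a], hence [1]: setting [x] or [y]
     to 0 shows that the required elements are in [S]. *)
  case: M0T; apply: idealT_1 => //; have [_ M0D _] := idM0.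
  rewrite -(subrK a 1); apply: M0D; apply: mem_M0 => x.
  + by exists 0, x; rewrite mulr0 subr0 mul1r.
  + by exists x, 0; rewrite mulr0 subr0 mulr1.
(* If [M] and [N] are distinct maximal ideals above [P], some [a] in [N] has [1 - a] in [M]. The
   vanishing product puts [1 - a x] in [N] or [1 - (1 - a) y] in [M], and either ideal would then
   contain [1]. *)
- have [M [maxM PM]] := exists_maximal_ideal idP P1.
  exists M; split=> // N [maxN PN]; apply: contrapT => MN.
  have [idM MT _] := maxM; have [idN NT maxN'] := maxN.
  have [b Mb Nb] : exists2 b, M b & ~ N b.
    apply: contrapT => MsubN; apply: MN.
    case: maxM => _ _ /(_ N idN)[|->//|//] z Mz.
    by apply: contrapT => Nz; apply: MsubN; exists z.
  have : ideal_adjoin N b 1.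
    case: (maxN' (ideal_adjoin N b)) => [||NE|->//].
    - exact: ideal_adjoinP.
    - exact: sub_ideal_adjoin.
    - by case: Nb; rewrite -NE; exact: mem_ideal_adjoin.
  move=> [a Na [c e]].
  have M1a : M (1 - a) by rewrite e addrAC subrr add0r; case: idM => _ _; apply.
  have [x [y eq0]] := contessa a.
  have unit_notin I d z : ideal I -> I <> [set: A] -> I d -> ~ I (1 - d * z).
    move=> idI /(proper_ideal_1 idI) IT Id I1; apply: IT; have [_ ID IM] := idI.
    by rewrite -(subrK (d * z) 1); apply: ID => //; rewrite mulrC; exact: IM.
  have := prP (1 - a * x) (1 - (1 - a) * y); rewrite eq0; have [P0 _ _] := idP.
  by case=> // [/PN|/PM]; apply: unit_notin.
Qed.

End IdealTheory.

(** * Componentwise constructions in the product ring *)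

Section Product.
Variables (F : Type) (A : F -> comPzRingType).

Lemma prod_ring_1E i : (1 : prod_ring A) i = 1.
Proof. by []. Qed.

Lemma prod_ring_mulE (f g : prod_ring A) i : (f * g) i = f i * g i.
Proof. by []. Qed.

Lemma prod_ring_expE (f : prod_ring A) n i : (f ^+ n) i = f i ^+ n.
Proof. by elim: n => // n IHn; rewrite !exprS -IHn. Qed.

Lemma prod_ring_ext (f g : prod_ring A) : (forall i, f i = g i) -> f = g.
Proof. exact: functional_extensionality_dep. Qed.

(** As [A j] depends on [j], the new value is specified by transport along every proof of [i = j];
    proof irrelevance makes the transport along a loop trivial. *)
Lemma prod_ring_update (f : prod_ring A) i (x : A i) :
  exists g : prod_ring A, g i = x /\ forall j, j <> i -> g j = f j.
Proof.
suff /all_sig[g gP] : forall j, {y : A j |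
    (forall e : i = j, y = eq_rect i A x j e) /\ (j <> i -> y = f j)}.
  exists g; split; first by have [/(_ erefl)] := gP i.
  by move=> j; have [_] := gP j.
move=> j; have [e|ne] := pselect (i = j).
  case: j / e; exists x; split=> // e.
  by rewrite (Prop_irrelevance e erefl).
by exists (f j); split=> // e; case: ne.
Qed.

Lemma dep_choice (T : F -> Type) (P : forall i, T i -> Prop) :
  (forall i, exists y, P i y) -> exists f, forall i, P i (f i).
Proof. by move=> exP; have [f fP] := all_sig (fun i => cid (exP i)); exists f. Qed.

(** Contessa's criterion is an equation in elements, so solutions chosen in the factors assemble
    into one in the product, with no description of its prime ideals. *)
Lemma pm_ring_prod : (forall i, pm_ring (A i)) -> pm_ring (prod_ring A).
Proof.
move=> pmA; apply/pm_ringP => a.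
have /dep_choice[x /dep_choice[y xy0]] i := (pm_ringP (A i)).1 (pmA i) (a i).
by exists x, y; apply: prod_ring_ext => i; exact: xy0.
Qed.

Lemma principal2_prod (a b : prod_ring A) :
  (forall i, principal (gen_ideal [set a i; b i])) ->
  principal (gen_ideal [set a; b]).
Proof.
move=> ab; apply/principal2P.
have /dep_choice[d /dep_choice[x /dep_choice[y /dep_choice[u /dep_choice[v H]]]]] i :=
  (principal2P (a i) (b i)).1 (ab i).
by exists d, x, y, u, v; split; apply: prod_ring_ext => i; have [] := H i.
Qed.

(** * Transition axioms for the disjoint union of the maps *)

Variables (L : F -> Type) (psi : forall i, A i -> set (L i)).

Definition prod_map (a : prod_ring A) : set {i & L i} :=
  [set p | psi (a (tag p)) (tagged p)].

Lemma prod_map_cap0 (a b : prod_ring A) :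
  prod_map a `&` prod_map b = set0 <->
  forall i, psi (a i) `&` psi (b i) = set0.
Proof.
split=> [ab i|ab]; rewrite -subset0; last first.
  by move=> [i l] /= abl; rewrite -[False]/(set0 l) -(ab i).
move=> l abl; have : (prod_map a `&` prod_map b) (Tagged L l) by [].
by rewrite ab.
Qed.

Hypothesis psi_transition : forall i, transition_map (@psi i).

Lemma prod_map_full (a : prod_ring A) : prod_map a = [set: {i & L i}] <-> a = 0.
Proof.
have psi_full i := stm_full (tm_semi (psi_transition i)).
split=> [aT|->]; last first.
  apply/seteqP; split=> // -[i l] _.
  by have [_ /(_ erefl)/seteqP[_]] := psi_full i 0; exact.
apply: prod_ring_ext => i; apply/psi_full/seteqP; split=> // l _.
have : prod_map a (Tagged L l) by rewrite aT.
by [].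
Qed.

(** The coefficients [u i], [v i] are chosen rather than the elements [c] of the factors, so that
    the assembled element visibly lies in the ideal of [a] and [b]. *)
Lemma prod_map_cap (a b : prod_ring A) : exists c,
  [/\ gen_ideal [set a; b] c, prod_map a `&` prod_map b = prod_map c
    & prod_map c `<=` prod_map (a + b)].
Proof.
have /dep_choice[u /dep_choice[v H]] i : exists u v : A i,
    psi (a i) `&` psi (b i) = psi (u * a i + v * b i) /\
    psi (u * a i + v * b i) `<=` psi (a i + b i).
  have [c []] := stm_cap (tm_semi (psi_transition i)) (a i) (b i).
  by rewrite gen_ideal2E => -[u [v ->]]; exists u, v.
exists ((u : prod_ring A) * a + (v : prod_ring A) * b); split.
- by rewrite gen_ideal2E; exists u, v.
- apply/seteqP; split=> -[i l]; have [E _] := H i.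
    by move=> abl; rewrite /prod_map /= -E.
  by rewrite {1}/prod_map /= -E.
- by move=> [i l]; have [_] := H i; exact.
Qed.

Lemma prod_map_T1 (p q : {i & L i}) : p <> q ->
  exists a, (prod_map a p /\ ~ prod_map a q) \/ (~ prod_map a p /\ prod_map a q).
Proof.
case: p q => [i l] [j k]; have [e|ne] := pselect (i = j).
  case: j / e k => k lk.
  have [e|a ha] := tm_T1 (psi_transition i) (l1 := l) (l2 := k).
    by case: lk; rewrite e.
  by have [f [fi _]] := prod_ring_update 0 a; exists f; rewrite /prod_map /= fi.
(* For different indices, take 0 at [i] and 1 elsewhere: its image is everything over [i] and empty
   over [j]. *)
move=> _; have [f [fi fj]] := prod_ring_update 1 (0 : A i).
exists f; left; rewrite /prod_map /= fi fj; last by move=> /esym.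
rewrite (stm_full (tm_semi (psi_transition i)) 0).2 //; split=> //.
by rewrite prod_ring_1E (stm_one (tm_semi (psi_transition j))) => -[].
Qed.

Lemma prod_map_T2 (p : {i & L i}) (a : prod_ring A) : ~ prod_map a p ->
  exists b, prod_map b p /\ prod_map a `&` prod_map b = set0.
Proof.
case: p => i l /(tm_T2 (psi_transition i))[b [bl ab]].
(* The default value 1 has empty image, so only index [i] matters for disjointness. *)
have [f [fi fj]] := prod_ring_update 1 b.
exists f; split; first by rewrite /prod_map /= fi.
apply/prod_map_cap0 => j; have [->|/fj ->] := pselect (j = i); first by rewrite fi.
by rewrite prod_ring_1E (stm_one (tm_semi (psi_transition j))) setI0.
Qed.

End Product.

Theorem theorem5p4 (F : Type) (hF : inhabited F) (A : F -> comPzRingType)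
    (hpm : forall i : F, pm_ring (A i))
    (L : F -> Type) (psi : forall i : F, A i -> set (L i))
    (hpsi : forall i : F, transition_map (@psi i))
    (m : nat) (hm : (0 < m)%N)
    (hprinc : forall (i : F) (a b : A i), psi i a `&` psi i b = set0 ->
       principal (gen_ideal [set a ^+ m; b ^+ m])) :
  transitional (prod_ring A).
Proof.
have pmA := pm_ring_prod hpm; split=> //.
exists {i & L i}, (prod_map psi); split=> //.
- split.
  + by case: hF => i; have [l] := stm_nonempty (tm_semi (hpsi i)); exists; exists i.
  + move=> a b; apply/seteqP; split=> -[i l];
      by rewrite /prod_map /= prod_ring_mulE (stm_mul (tm_semi (hpsi i))).
  + rewrite -subset0 => -[i l]; rewrite /prod_map /=.
    by rewrite prod_ring_1E (stm_one (tm_semi (hpsi i))).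
  + exact: prod_map_full.
  + exact: prod_map_cap.
  (* Powers in the product are componentwise, so one exponent has to serve at all indices. *)
  + move=> a b /prod_map_cap0 ab; exists m, m; split=> //.
    by apply: principal2_prod => i; rewrite !prod_ring_expE; exact: hprinc.
- exact: prod_map_T1.
- exact: prod_map_T2.
Qed.
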